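(* Let $G=(V,\mathcal E,w)$ be an undirected, connected, weighted graph on $n$ nodes with Laplacian $L$. Fix one of the six uncertainty structures listed in the context, and fix a time-delay $\tau>0$. Suppose the agents are labeled $1,\dots,n$ so that, in the delay-free network ($\tau=0$) with Laplacian $L$, agent $i$ precedes agent $j$ in the order of precedence (i.e. has strictly larger centrality index) if and only if $i<j$. Similarly, suppose the links are labeled $1,\dots,|\mathcal E|$ so that, in the delay-free network, link $e$ has higher rank than link $f$ if and only if $e<f$. Then there exists $\alpha>0$ such that, in the network with all weights scaled by $\alpha$ (Laplacian $\alpha L$) and with time-delay $\tau$, agent $i$ has rank $i$ for every $i\in\{1,\dots,n\}$ and link $e$ has rank $e$ for every $e\in\{1,\dots,|\mathcal E|\}$. In other words, this network has the same order of precedence and ranking as the delay-free network with the same type of uncertainty.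
   Context: Graph matrices: - $E$ is the signed incidence matrix and $W=\mathrm{diag}(w(e))$. - $L=EWE^T$, $\Delta$ is the weighted-degree matrix, $A=\Delta-L$. - $M_n=I_n-\frac1n\mathbf1\mathbf1^T$. - $\lambda_n$ is the largest eigenvalue of the Laplacian in use; the network with delay $\tau$ and Laplacian $\alpha L$ is considered for $\tau\alpha\lambda_n(L)<\pi/2$. The network is $$\dot x(t)=-L\,x(t-\tau)+B\,\xi(t),\qquad y=M_nx,$$ with $\xi$ a vector of mutually independent zero-mean Gaussian white noises with intensities $\sigma_k^2$. The six uncertainty structures are: - agent-associated: dynamics $B=I_n$; sensor $B=L$; receiver $B=\Delta$; emitter $B=A$; - link-associated: communication $B=EW$; measurement $B=-E$. In each case $B$ is built from the (scaled) weights. The performance is $$\rho_{ss}=\lim_{t\to\infty}\mathbb E[y^Ty]=\frac1{2\pi}\int\mathrm{Tr}[G^HG]d\omega,\qquad G(s)=M_n(sI+e^{-\tau s}L)^{-1}B\,\mathrm{diag}(\sigma_k).$$ Agent centrality is $\eta_i=\partial\rho_{ss}/\partial\sigma_i^2$ and link centrality is $\nu_e=\partial\rho_{ss}/\partial\sigma_e^2$, defined for agent- and link-associated structures respectively. Agent $i$ precedes agent $j$ if $\eta_i>\eta_j$; link $e$ has higher rank than link $f$ if $\nu_e>\nu_f$. *)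

(* Defs.v *)
From HB Require Import structures.
From mathcomp Require Import all_boot all_order all_algebra.
From mathcomp Require Import all_classical all_reals all_analysis.
From mathcomp Require Import complex.
Unset Printing Implicit Defensive.
Import Order.TTheory GRing.Theory Num.Theory.
Local Open Scope ring_scope.

Inductive unc := Dynamics | Sensor | Receiver | Emitter | Communication | Measurement.

Definition agent_assoc (u : unc) : bool :=
  match u with Communication | Measurement => false | _ => true end.

(* number of noise channels: n (agents) or m (links) *)
Definition ndim (u : unc) (n m : nat) : nat := if agent_assoc u then n else m.

Section Network.
Variables (R : realType) (n m : nat).
Variable ends : 'I_m -> 'I_n * 'I_n.   (* edge e joins (ends e).1 and (ends e).2, arbitrary orientation *)

Definition adj : rel 'I_n := fun i j =>
  [exists e : 'I_m, (ends e == (i, j)) || (ends e == (j, i))].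

Definition weighted_graph (w : 'I_m -> R) : Prop :=
  [/\ forall e, (ends e).1 != (ends e).2,
      forall e f, (ends e == ends f) || (ends e == ((ends f).2, (ends f).1)) -> e = f,
      forall e, 0 < w e
    & forall i j, connect adj i j].

Definition incidence : 'M[R]_(n, m) :=
  \matrix_(i, e) (((i == (ends e).1) : nat)%:R - ((i == (ends e).2) : nat)%:R).

Definition Wmat (w : 'I_m -> R) : 'M[R]_m := diag_mx (\row_e w e).

Definition laplacian (w : 'I_m -> R) : 'M[R]_n := incidence *m Wmat w *m incidence^T.

Definition degmat (w : 'I_m -> R) : 'M[R]_n :=
  diag_mx (\row_i (\sum_(e | (i == (ends e).1) || (i == (ends e).2)) w e)).

Definition adjmat (w : 'I_m -> R) : 'M[R]_n := degmat w - laplacian w.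

Definition Bmat (u : unc) (w : 'I_m -> R) : 'M[R]_(n, ndim u n m) :=
  match u return 'M[R]_(n, ndim u n m) with
  | Dynamics => 1%:M
  | Sensor => laplacian w
  | Receiver => degmat w
  | Emitter => adjmat w
  | Communication => incidence *m Wmat w
  | Measurement => - incidence
  end.

Definition Mcent : 'M[R]_n := 1%:M - (n%:R)^-1 *: const_mx 1.

Local Open Scope complex_scope.

Definition Cmx {p q : nat} (M : 'M[R]_(p, q)) : 'M[R[i]]_(p, q) := map_mx (fun x => x%:C) M.

Definition adjC {p q : nat} (M : 'M[R[i]]_(p, q)) : 'M[R[i]]_(q, p) := map_mx conjc M^T.

(* G(j omega) = M_n (j omega I + e^{-j omega tau} L)^{-1} B diag(sigma_k),
   with e^{-j omega tau} = cos(omega tau) - j sin(omega tau),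
   sigma_k = sqrt(s k) where s k is the noise intensity sigma_k^2. *)
Definition transfer (u : unc) (w : 'I_m -> R) (tau : R) (s : 'I_(ndim u n m) -> R)
  (om : R) : 'M[R[i]]_(n, ndim u n m) :=
  Cmx Mcent
  *m invmx ((0 +i* om) *: 1%:M + (cos (om * tau) -i* sin (om * tau)) *: Cmx (laplacian w))
  *m Cmx (Bmat u w *m diag_mx (\row_k Num.sqrt (s k))).

Definition rho_ss (u : unc) (w : 'I_m -> R) (tau : R) (s : 'I_(ndim u n m) -> R) : R :=
  (2 * pi)^-1 * Rintegral (@lebesgue_measure R) setT
     (fun om => @complex.Re R (\tr (adjC (transfer u w tau s om) *m transfer u w tau s om))).

(* centrality index of noise channel k (agent or link):
   partial derivative of rho_ss w.r.t. sigma_k^2, taken at unit intensities *)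
Definition centrality (u : unc) (w : 'I_m -> R) (tau : R) (k : 'I_(ndim u n m)) : R :=
  derive1 (fun t => rho_ss u w tau (fun l => 1 + t * ((l == k) : nat)%:R)) 0.

(* the delayed network with Laplacian L is considered only when tau lambda_n(L) < pi/2 *)
Definition delay_admissible (w : 'I_m -> R) (tau : R) : Prop :=
  forall lam : R, eigenvalue (laplacian w) lam -> tau * lam < pi / 2.

End Network.

Definition scale_w (R : realType) (m : nat) (alpha : R) (w : 'I_m -> R) : 'I_m -> R :=
  fun e => alpha * w e.

(* Main.v *)
(** Diagonalise [L = P^H diag(d) P] with [P] unitary. Connectedness makes the
    kernel of [L] the constant vectors, so [M_n] removes exactly the modes with
    [d_i = 0], and the centrality of channel [k] is
    [(2 pi)^-1 sum_(d_i <> 0) |(P B)_ik|^2 I(d_i, tau)], where [I(lam, tau)] is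
    the integral over [nu] of [|i nu + e^(-i nu tau) lam|^-2]. The substitution
    [nu -> alpha nu] gives [I(alpha lam, tau) = alpha^-1 I(lam, alpha tau)], so
    that scaling the weights by [alpha] multiplies all centralities by a common
    positive factor and replaces [tau] by [alpha tau]. Since [I(lam, del)] tends
    to [I(lam, 0)] as [del] tends to [0], the finitely many strict inequalities
    of the delay-free ranking persist for small [alpha]. *)

Require Import Defs.
From HB Require Import structures.
From mathcomp Require Import all_boot all_order all_algebra.
From mathcomp Require Import all_classical all_reals all_analysis.
From mathcomp Require Import measurable_realfun complex spectral ring lra.
Import Order.TTheory GRing.Theory Num.Theory.
Import numFieldNormedType.Exports.
Local Open Scope classical_set_scope.
Local Open Scope ring_scope.
Set Implicit Arguments.
Unset Strict Implicit.

(** * The scalar frequency integral of one mode, its limit at zero delay and its scaling *)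

Section DelayKernel.
Context {R : realType}.
Local Notation mu := (@lebesgue_measure R).

Lemma ler_norm_sin (x : R) : `|sin x| <= `|x|.
Proof.
wlog x0 : x / 0 <= x.
  move=> H; have [/H//|/ltW x0] := leP 0 x.
  by rewrite -normrN -sinN -(normrN x) H// oppr_ge0.
have [c _] := @MVT_segment R sin cos 0 x x0 (fun y _ => is_derive_sin y)
  (continuous_subspaceT (@continuous_sin R)).
rewrite sin0 !subr0 => ->; rewrite normrM ler_piMl//.
exact: cos_max.
Qed.

(* [|i nu + e^(-i nu del) lam|^2], see [normsq_delay] *)
Definition delay_den (lam del nu : R) : R :=
  lam ^+ 2 + nu ^+ 2 - 2 * nu * lam * sin (nu * del).

Definition delay_int (lam del : R) : R :=
  \int[mu]_nu (delay_den lam del nu)^-1.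

Lemma delay_den_cross (lam del nu : R) : 0 <= del ->
  `|2 * nu * lam * sin (nu * del)| <= 2 * (`|lam| * del) * nu ^+ 2.
Proof.
move=> del0; rewrite 3!normrM -(real_normK (num_real nu)).
rewrite normr_nat.
have := ler_norm_sin (nu * del); rewrite normrM (ger0_norm del0) => H.
rewrite [leRHS](_ : _ = 2 * `|nu| * `|lam| * (`|nu| * del)); last ring.
by apply: ler_wpM2l => //; rewrite !mulr_ge0.
Qed.

(** The bound [1/4] makes the cross term at most half of [nu ^+ 2]. It is stricter than the
    stability bound [pi / 2], which costs nothing since the scaling may be chosen small. *)
Lemma delay_den_ge (lam del nu : R) : 0 <= del -> `|lam| * del <= 4^-1 ->
  lam ^+ 2 + 2^-1 * nu ^+ 2 <= delay_den lam del nu.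
Proof.
move=> del0 small; have := delay_den_cross lam nu del0.
rewrite ler_norml => /andP[_ H].
have : `|lam| * del * nu ^+ 2 <= 4^-1 * nu ^+ 2 by rewrite ler_wpM2r// sqr_ge0.
rewrite /delay_den; lra.
Qed.

Lemma delay_den_gt0 (lam del nu : R) : lam != 0 -> 0 <= del ->
  `|lam| * del <= 4^-1 -> 0 < delay_den lam del nu.
Proof.
move=> lam0 del0 small; apply: lt_le_trans (delay_den_ge nu del0 small).
by rewrite ltr_pwDl ?exprn_even_gt0//= mulr_ge0 ?sqr_ge0.
Qed.

(** An integrable majorant that does not depend on [del]. Expanding [(lam ^- 2 + 2) * (lam ^+ 2 + nu
    ^+ 2 / 2)] yields [1 + nu ^+ 2] plus nonnegative terms. *)
Lemma delay_den_inv_le (lam del nu : R) : lam != 0 -> 0 <= del ->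
  `|lam| * del <= 4^-1 ->
  (delay_den lam del nu)^-1 <= (lam ^- 2 + 2) * (oneDsqr nu)^-1.
Proof.
move=> lam0 del0 small; have H := delay_den_ge nu del0 small.
have D0 := delay_den_gt0 nu lam0 del0 small.
have l2 : 0 < lam ^+ 2 by rewrite exprn_even_gt0.
have n2 : 0 <= nu ^+ 2 by rewrite sqr_ge0.
have lV : 0 < lam ^- 2 by rewrite invr_gt0.
have O0 : 0 < oneDsqr nu by exact: lt_le_trans ltr01 (oneDsqr_ge1 nu).
rewrite ler_pdivlMr// mulrC ler_pdivrMr//.
apply: (@le_trans _ _ ((lam ^- 2 + 2) * (lam ^+ 2 + 2^-1 * nu ^+ 2))); last first.
  by rewrite ler_wpM2l// addr_ge0// ltW.
rewrite /oneDsqr mulrDl !mulrDr mulVf ?gt_eqF//.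
have : 0 <= lam ^- 2 * (2^-1 * nu ^+ 2) by rewrite mulr_ge0 ?(ltW lV)// mulr_ge0.
lra.
Qed.

Lemma continuous_delay_den (lam del : R) : continuous (delay_den lam del).
Proof.
move=> nu; rewrite /delay_den; apply: cvgB.
  by apply: cvgD; [exact: cvg_cst|exact: exprn_continuous].
apply: cvgM; last first.
  have := @continuous_comp R R R ( *%R^~ del) sin nu.
  by apply; [exact: mulrr_continuous|exact: continuous_sin].
by apply: cvgM; [apply: cvgM; [exact: cvg_cst|exact: cvg_id]|exact: cvg_cst].
Qed.

Lemma continuous_delay_inv (lam del : R) : lam != 0 -> 0 <= del ->
  `|lam| * del <= 4^-1 -> continuous (fun nu => (delay_den lam del nu)^-1).
Proof.
move=> lam0 del0 small nu; apply: cvgV; last exact: continuous_delay_den.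
by rewrite gt_eqF// delay_den_gt0.
Qed.

(** Evenness reduces the claim to the half-line, where the integral is known in closed form. *)
Lemma integrable_oneDsqrV : mu.-integrable setT (EFin \o (fun x : R => (oneDsqr x)^-1)).
Proof.
have c := @continuous_oneDsqrV R.
apply/integrableP; split.
  by apply/measurable_EFinP; exact: continuous_measurable_fun.
have p (x : R) : 0 <= (oneDsqr x)^-1 by rewrite invr_ge0 (le_trans ler01)// oneDsqr_ge1.
under eq_integral do rewrite /= ger0_norm//.
rewrite ge0_symfun_integralT//.
  by rewrite -set_itvcy integral0y_oneDsqr -EFinM ltry.
by move=> x; rewrite /= /oneDsqr sqrrN.
Qed.

Lemma integrable_delay (lam del : R) : lam != 0 -> 0 <= del ->
  `|lam| * del <= 4^-1 ->
  mu.-integrable setT (EFin \o (fun nu => (delay_den lam del nu)^-1)).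
Proof.
move=> lam0 del0 small.
apply: (@le_integrable _ _ _ mu setT _ _
  (fun x => (lam ^- 2 + 2)%:E * ((oneDsqr x)^-1)%:E)%E) => //.
- by apply/measurable_EFinP; apply: continuous_measurable_fun;
    exact: continuous_delay_inv.
- move=> x _ /=; rewrite lee_fin ger0_norm ?invr_ge0 ?(ltW (delay_den_gt0 _ _ _ _))//.
  by apply: (le_trans (delay_den_inv_le x lam0 del0 small)); rewrite ler_norm.
- by apply: integrableZl => //; exact: integrable_oneDsqrV.
Qed.

(** A Lipschitz estimate at delay 0: writing [1/a - 1/b] as [(b - a) / (a * b)], the cross term over
    the delay-free denominator is at most [2 * |lam| * del], and the remaining inverse has the
    integrable majorant. *)
Lemma delay_int_cvg (lam : R) : lam != 0 ->
  delay_int lam del @[del --> 0^'+] --> delay_int lam 0.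
Proof.
move=> lam0.
set K := 2 * `|lam| * \int[mu]_nu ((lam ^- 2 + 2) * (oneDsqr nu)^-1).
suff: \forall del \near 0^'+, `|delay_int lam 0 - delay_int lam del| <= K * del.
  move=> H; apply/cvgrPdist_le => e e0; near=> del.
  apply: (@le_trans _ _ (K * del)); first by near: del.
  (* The factor [|K| + 1] is visibly positive, so it can be divided by. *)
  apply: (@le_trans _ _ ((`|K| + 1) * del)).
    by rewrite ler_wpM2r// (le_trans (ler_norm _))// lerDl.
  rewrite -ler_pdivlMl ?ltr_wpDl//.
  near: del; apply: nbhs_right_le.
  by rewrite mulr_gt0// invr_gt0 ltr_wpDl.
near=> del.
have del0 : 0 <= del by [].
have small : `|lam| * del <= 4^-1.
  rewrite mulrC -ler_pdivlMr ?normr_gt0//; near: del; apply: nbhs_right_le.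
  by rewrite divr_gt0 ?normr_gt0.
have small0 : `|lam| * 0 <= 4^-1 by rewrite mulr0.
have i1 := integrable_delay lam0 (lexx _) small0.
have i2 := integrable_delay lam0 del0 small.
have i3 : mu.-integrable setT
    (EFin \o (fun nu => (lam ^- 2 + 2) * (oneDsqr nu)^-1)).
  rewrite [X in integrable _ _ X](_ : _ =
    (fun x => (lam ^- 2 + 2)%:E * ((oneDsqr x)^-1)%:E)%E)//.
  by apply: integrableZl => //; exact: integrable_oneDsqrV.
rewrite /delay_int -RintegralB//.
have i4 : mu.-integrable setT
   (EFin \o (fun nu => (delay_den lam 0 nu)^-1 - (delay_den lam del nu)^-1)).
  exact: (integrableB measurableT i1 i2).
apply: (le_trans (le_normr_Rintegral _ i4)) => //.
rewrite /K mulrAC -RintegralZl//.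
apply: le_Rintegral => //.
- exact: integrable_norm.
- rewrite [X in integrable _ _ X](_ : _ =
    (fun x => (2 * `|lam| * del)%:E * ((lam ^- 2 + 2) * (oneDsqr x)^-1)%:E)%E)//.
  exact: integrableZl.
move=> nu _.
have p0 := delay_den_gt0 nu lam0 (lexx _) small0.
have pd := delay_den_gt0 nu lam0 del0 small.
have -> : (delay_den lam 0 nu)^-1 - (delay_den lam del nu)^-1 =
   - (2 * nu * lam * sin (nu * del)) * (delay_den lam 0 nu)^-1
     * (delay_den lam del nu)^-1.
  have -> : 2 * nu * lam * sin (nu * del) =
      delay_den lam 0 nu - delay_den lam del nu.
    by rewrite /delay_den mulr0 sin0; ring.
  by field; rewrite !gt_eqF.
rewrite normrM normrM normrN.
rewrite [X in _ * X]ger0_norm ?invr_ge0 ?(ltW pd)//.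
rewrite (@ger0_norm _ (delay_den lam 0 nu)^-1) ?invr_ge0 ?(ltW p0)//.
apply: ler_pM => //.
- by rewrite mulr_ge0// invr_ge0 ltW.
- by rewrite invr_ge0 ltW.
(* At delay 0 the denominator is [lam ^+ 2 + nu ^+ 2], which dominates the [nu ^+ 2] in the bound on
   the cross term. *)
- rewrite ler_pdivrMr//.
  apply: (le_trans (delay_den_cross lam nu del0)).
  rewrite (mulrA 2) ler_wpM2l ?mulr_ge0//.
  by rewrite /delay_den mulr0 sin0 mulr0 subr0 lerDr sqr_ge0.
- exact: delay_den_inv_le.
Unshelve. all: end_near. Qed.

(** Homogeneity: [delay_den (a * lam) tau (a * nu)] is [a ^+ 2] times [delay_den lam (a * tau) nu],
    and the substitution contributes one factor [a]. *)
Lemma delay_int_scale (a lam tau : R) : 0 < a -> lam != 0 -> 0 <= tau ->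
  `|lam| * (a * tau) <= 4^-1 ->
  delay_int (a * lam) tau = a^-1 * delay_int lam (a * tau).
Proof.
move=> a0 lam0 tau0 small.
have alam0 : a * lam != 0 by rewrite mulf_neq0// gt_eqF.
have small' : `|a * lam| * tau <= 4^-1.
  by rewrite normrM (gtr0_norm a0) (mulrC a) -mulrA.
have dFx (x : R) : is_derive x 1 ( *%R a : R -> R) a.
  have := @is_deriveM _ _ (cst a) id x 1 _ _ (is_derive_cst a x 1) (is_derive_id x 1).
  by rewrite /= scaler0 addr0 /GRing.scale/= mulr1.
have dF : derive1 ( *%R a : R -> R) = cst a.
  by apply/funext => x; rewrite derive1E; apply: derive_val.
have i1 : mu.-integrable setT
    (EFin \o (fun nu => (delay_den lam (a * tau) nu)^-1)).
  by apply: integrable_delay => //; rewrite mulr_ge0// ltW.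
rewrite -RintegralZl//.
congr fine.
rewrite (@increasing_ge0_integration_by_substitutionT _ ( *%R a)
  (fun nu => (delay_den (a * lam) tau nu)^-1)).
- apply: eq_integral => nu _; congr EFin.
  rewrite dF /= -invfM [a * delay_den _ _ _](_ : _ = a^-1 * delay_den (a * lam) tau (a * nu)); last first.
    rewrite /delay_den (mulrA nu) (mulrC nu a).
    by field; rewrite gt_eqF.
  by rewrite invfM invrK mulrC.
- by move=> x y xy; rewrite ltr_pM2l.
- by rewrite dF; exact: cst_continuous.
- by rewrite dF; exact: is_cvg_cst.
- by rewrite dF; exact: is_cvg_cst.
- by move=> x; exact: (@ex_derive _ _ _ _ _ _ _ (dFx x)).
- exact: gt0_cvgMrNy.
- exact: gt0_cvgMry.
- by apply: continuous_delay_inv.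
- by move=> x; rewrite invr_ge0 ltW// delay_den_gt0.
Qed.
End DelayKernel.

(** * Squared moduli, conjugate transposes and the spectral theorem *)

Section ComplexMatrix.
Context {R : realType}.
Local Open Scope complex_scope.
Implicit Types (p q r : nat).

Definition normsq (z : R[i]) : R := complex.Re z ^+ 2 + complex.Im z ^+ 2.

Lemma normsq_conj (z : R[i]) : conjc z * z = (normsq z)%:C.
Proof. by rewrite mulrC -sqr_normc add_Re2_Im2. Qed.

Lemma normsqM (x y : R[i]) : normsq (x * y) = normsq x * normsq y.
Proof. by case: x y => [a b] [c d]; rewrite /normsq /=; ring. Qed.

Lemma normsq_real (x : R) : normsq x%:C = x ^+ 2.
Proof. by rewrite /normsq /= expr0n addr0. Qed.

Lemma normsqV (z : R[i]) : z != 0 -> normsq z^-1 = (normsq z)^-1.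
Proof.
move=> z0; have : normsq z * normsq z^-1 = 1.
  by rewrite -normsqM divff// /normsq /= expr0n addr0 expr1n.
move=> H; have n0 : normsq z != 0.
  by apply/eqP => E; move: H; rewrite E mul0r => /esym/eqP; rewrite oner_eq0.
by rewrite -[RHS]mulr1 -H mulKf.
Qed.

Lemma normsq_ge0 (z : R[i]) : 0 <= normsq z.
Proof. by rewrite addr_ge0// sqr_ge0. Qed.

Lemma normsq_eq0 (z : R[i]) : normsq z = 0 -> z = 0.
Proof.
case: z => a b /eqP; rewrite paddr_eq0 ?sqr_ge0//= !sqrf_eq0.
by move=> /andP[/eqP -> /eqP ->].
Qed.

Lemma Cmx_mul p q r (A : 'M[R]_(p, q)) (B : 'M[R]_(q, r)) :
  Cmx R (A *m B) = Cmx R A *m Cmx R B.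
Proof. exact: (map_mxM (real_complex R)). Qed.

Lemma adjC_mul p q r (A : 'M[R[i]]_(p, q)) (B : 'M[R[i]]_(q, r)) :
  adjC R (A *m B) = adjC R B *m adjC R A.
Proof. by rewrite /adjC trmx_mul (map_mxM (@conjc R)). Qed.

Lemma adjCK p q (A : 'M[R[i]]_(p, q)) : adjC R (adjC R A) = A.
Proof. by apply/matrixP => i j; rewrite !mxE conjcK. Qed.

Lemma adjC_Cmx p q (A : 'M[R]_(p, q)) : adjC R (Cmx R A) = Cmx R A^T.
Proof. by apply/matrixP => i j; rewrite !mxE conjc_real. Qed.

Lemma trace_adjC_mul p q (N : 'M[R[i]]_(p, q)) :
  \tr (adjC R N *m N) = (\sum_k \sum_i normsq (N i k))%:C.
Proof.
rewrite (rmorph_sum (real_complex R)); apply: eq_bigr => k _.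
rewrite (rmorph_sum (real_complex R)) mxE; apply: eq_bigr => i _.
by rewrite !mxE normsq_conj.
Qed.

(** The complexification of [A] is Hermitian, hence unitarily diagonalisable with real spectrum;
    this is why [d] can take values in [R] although [P] is complex. *)
Lemma symmetric_spectral p (A : 'M[R]_p) : A^T = A ->
  exists (P : 'M[R[i]]_p) (d : 'I_p -> R),
    P *m adjC R P = 1%:M /\
    Cmx R A = adjC R P *m diag_mx (\row_i (d i)%:C) *m P.
Proof.
move=> symA.
have hA : Cmx R A \is hermsymmx.
  apply: realsym_hermsym.
    apply/is_hermitianmxP; rewrite expr0 scale1r map_mx_id//.
    by apply/matrixP => i j; rewrite !mxE -[in LHS]symA mxE.
  by apply/mxOverP => i j; rewrite mxE complex_real.
have /mxOverP dreal := hermitian_spectral_diag_real hA.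
have U := spectral_unitarymx (Cmx R A).
exists (spectralmx (Cmx R A)).
exists (fun i => complex.Re (spectral_diag (Cmx R A) ord0 i)); split.
  exact/unitarymxP.
have /orthomx_spectralP E := hermitian_normalmx hA.
rewrite [LHS]E invmx_unitary//; congr (_ *m _ *m _); congr diag_mx.
by apply/rowP => i; rewrite mxE RRe_real.
Qed.

Lemma sum_delta_mul (S : pzRingType) p (a : 'I_p) (f : 'I_p -> S) :
  \sum_i ((i == a) : nat)%:R * f i = f a.
Proof.
by rewrite (bigD1 a)//= eqxx mul1r big1 ?addr0// => i /negbTE ->; rewrite mul0r.
Qed.

End ComplexMatrix.

(** * Kernel of the Laplacian and diagonal forms of the centering matrix and the resolvent *)

Section Spectral.
Context {R : realType} {n m : nat}.
Variable ends : 'I_m -> 'I_n * 'I_n.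
Implicit Type w : 'I_m -> R.
Local Open Scope complex_scope.
Local Notation E := (incidence R n m ends).
Local Notation L := (laplacian R n m ends).

Lemma laplacian_sym w : (L w)^T = L w.
Proof. by rewrite /laplacian !trmx_mul trmxK tr_diag_mx mulmxA. Qed.

Lemma ones_incidence : (const_mx 1 : 'M[R]_(n, n)) *m E = 0.
Proof.
apply/matrixP => i e; rewrite !mxE.
under eq_bigr do rewrite !mxE mulrBr mulrC [X in _ - X]mulrC.
by rewrite sumrB !sum_delta_mul subrr.
Qed.

Lemma Mcent_laplacian w : Mcent R n *m L w = L w.
Proof.
rewrite /Mcent mulmxBl mul1mx -scalemxAl /laplacian !mulmxA ones_incidence.
by rewrite !mul0mx scaler0 subr0.
Qed.

Lemma incidence_tr_mul (v : 'cV[R[i]]_n) e :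
  (Cmx R E^T *m v) e 0 = v (ends e).1 0 - v (ends e).2 0.
Proof.
rewrite mxE; under eq_bigr do rewrite !mxE (rmorphB (real_complex R)) !rmorph_nat mulrBl.
by rewrite sumrB !sum_delta_mul.
Qed.

(** The quadratic form of [L] at [v] is the sum over the links of [w e] times the squared modulus of
    the difference of [v] along [e]. If it vanishes, positivity of the weights kills every
    difference, and connectedness propagates equality. *)
Lemma laplacian_ker w (v : 'cV[R[i]]_n) : weighted_graph R n m ends w ->
  Cmx R (L w) *m v = 0 -> forall i j, v i 0 = v j 0.
Proof.
move=> [_ _ wpos conn] Lv0.
set y := Cmx R E^T *m v.
have q0 : \sum_e w e * normsq (y e 0) = 0.
  apply: (@complexI R); rewrite (rmorph_sum (real_complex R)).
  transitivity ((adjC R v *m (Cmx R (L w) *m v)) 0 0); last by rewrite Lv0 mulmx0 mxE.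
  rewrite /laplacian !Cmx_mul !mulmxA -/y -[Cmx R E]adjCK adjC_Cmx -adjC_mul -/y.
  rewrite -mulmxA -/y mxE; apply: eq_bigr => e _.
  rewrite /Wmat /Cmx map_diag_mx mul_mx_diag !mxE.
  by rewrite rmorphM/= -normsq_conj mulrA (mulrC (w e)%:C).
have y0 e : y e 0 = 0.
  apply: normsq_eq0.
  have/eqP := q0; rewrite psumr_eq0; last first.
    by move=> f _; rewrite mulr_ge0 ?normsq_ge0// ltW.
  move=> /allP/(_ e (mem_index_enum _)) /=.
  by rewrite mulf_eq0 gt_eqF//= => /eqP.
have adjv i j : adj n m ends i j -> v i 0 = v j 0.
  move=> /existsP[e]; have := y0 e; rewrite incidence_tr_mul => /eqP.
  by rewrite subr_eq0 => /eqP H /orP[] /eqP De; move: H; rewrite De.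
move=> i j; have /connectP[p] := conn i j.
elim: p i => [|k p IH] i /=; first by move=> _ ->.
by move=> /andP[/adjv -> /IH H] /H.
Qed.

Definition laplacian_diag w (P : 'M[R[i]]_n) (d : 'I_n -> R) : Prop :=
  P *m adjC R P = 1%:M /\
  Cmx R (L w) = adjC R P *m diag_mx (\row_i (d i)%:C) *m P.

(** The columns of [adjC R P] are eigenvectors of [L]. One with eigenvalue 0 is constant and is
    annihilated by [Mcent]; any other is fixed, by dividing [Mcent *m L = L] by its eigenvalue. The
    multiplicity of 0 never has to be counted. *)
Lemma Mcent_diag w P d : weighted_graph R n m ends w -> laplacian_diag w P d ->
  Cmx R (Mcent R n) *m adjC R P =
  adjC R P *m diag_mx (\row_i ((d i != 0) : nat)%:R).
Proof.
move=> wg [PP LP].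
have LV : Cmx R (L w) *m adjC R P = adjC R P *m diag_mx (\row_i (d i)%:C).
  by rewrite LP -!mulmxA PP mulmx1.
have ML : Cmx R (Mcent R n) *m Cmx R (L w) = Cmx R (L w).
  by rewrite -Cmx_mul Mcent_laplacian.
apply/matrixP => i j.
rewrite mul_mx_diag [RHS]mxE [(\row_i _) _ _]mxE.
have [dj|dj] := eqVneq (d j) 0; rewrite ?mulr0 ?mulr1.
- set v := col j (adjC R P).
  have Lv : Cmx R (L w) *m v = 0.
    apply/colP => k; rewrite /v colE mulmxA LV -colE.
    by rewrite mul_mx_diag !mxE dj mulr0.
  have vc := laplacian_ker wg Lv.
  rewrite mxE (eq_bigr (fun k => Cmx R (Mcent R n) i k * adjC R P i j)); last first.
    by move=> k _; congr (_ * _); have := vc k i; rewrite /v !mxE.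
  (* Each row of [Mcent] sums to [1 - n / n]; the index [i] itself shows that [n] is nonzero. *)
  rewrite -mulr_suml [X in X * _](_ : _ = 0) ?mul0r//.
  under eq_bigr do rewrite !mxE mulr1 (rmorphB (real_complex R)).
  rewrite sumrB -(rmorph_sum (real_complex R)) -(rmorph_sum (real_complex R)).
  rewrite -rmorphB /= [X in X%:C](_ : _ = 0)//.
  rewrite sumr_const card_ord -[_ *+ n]mulr_natr mulVf; last first.
    by rewrite pnatr_eq0 -lt0n (leq_ltn_trans _ (ltn_ord i)).
  rewrite (bigD1 i)//= eqxx big1 ?addr0 ?subrr// => k /negbTE.
  by rewrite eq_sym => ->.
- have djC : (d j)%:C != 0 by rewrite -(inj_eq (@complexI R)) in dj.
  have := congr1 (fun A : 'M[R[i]]_n => (Cmx R (Mcent R n) *m A) i j) LV.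
  rewrite /= mulmxA ML LV mulmxA !mul_mx_diag.
  rewrite [LHS]mxE [RHS]mxE [(\row_i _) _ _]mxE.
  by move=> /(mulIf djC) ->.
Qed.

Lemma resolvent_diag w P d (z zeta : R[i]) : laplacian_diag w P d ->
  (forall i, z + zeta * (d i)%:C != 0) ->
  invmx (z *: 1%:M + zeta *: Cmx R (L w)) =
  adjC R P *m diag_mx (\row_i (z + zeta * (d i)%:C)^-1) *m P.
Proof.
move=> [PP LP] nz; have PP' := mulmx1C PP.
set X := (X in invmx X); set Y := RHS.
have EX : X = adjC R P *m diag_mx (\row_i (z + zeta * (d i)%:C)) *m P.
  have -> : diag_mx (\row_i (z + zeta * (d i)%:C)) =
     z *: 1%:M + zeta *: diag_mx (\row_i (d i)%:C).
    apply/matrixP => i j; rewrite !mxE; case: eqVneq => _ /=.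
      by rewrite !mulr1n mulr1.
    by rewrite !mulr0n !mulr0 addr0.
  rewrite mulmxDr mulmxDl -!scalemxAr -!scalemxAl mulmx1 PP'.
  by rewrite -LP.
(* For square matrices a right inverse suffices: it makes [X] a unit and equals [invmx X]. *)
have XY : X *m Y = 1%:M.
  rewrite EX /Y !mulmxA -(mulmxA _ P) PP mulmx1 -(mulmxA (adjC R P)) mulmx_diag.
  rewrite [diag_mx _](_ : _ = 1%:M) ?mulmx1//.
  apply/matrixP => i j; rewrite !mxE; case: eqVneq => //= _.
  by rewrite divff.
have [uX _] := mulmx1_unit XY.
by rewrite -[RHS](mulKmx uX) XY mulmx1.
Qed.

End Spectral.

(** * Finite sums of real integrals and change of an integrand at one point *)

Section RealIntegral.
Context {R : realType}.
Local Notation mu := (@lebesgue_measure R).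

Lemma integrable_Rsum (I : Type) (s : seq I) (P : pred I) (f : I -> R -> R) :
  (forall i, P i -> mu.-integrable setT (EFin \o f i)) ->
  mu.-integrable setT (EFin \o (fun x => \sum_(i <- s | P i) f i x)).
Proof.
move=> intf; rewrite [X in integrable _ _ X](_ : _ =
  (fun x => \sum_(i <- s | P i) (f i x)%:E)%E).
  by apply: integrable_sum.
by apply/funext => x /=; rewrite sumEFin.
Qed.

Lemma Rintegral_sum (I : Type) (s : seq I) (P : pred I) (f : I -> R -> R) :
  (forall i, P i -> mu.-integrable setT (EFin \o f i)) ->
  \int[mu]_x (\sum_(i <- s | P i) f i x) = \sum_(i <- s | P i) \int[mu]_x f i x.
Proof.
move=> intf; elim: s => [|i s IH].
  by under eq_Rintegral do rewrite big_nil; rewrite big_nil Rintegral_cst// mul0r.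
under eq_Rintegral do rewrite big_cons.
rewrite big_cons; case: ifPn => [Pi|_]; last exact: IH.
by rewrite RintegralD ?IH//; [exact: intf|exact: integrable_Rsum].
Qed.

Lemma integrable_Zl (c : R) (f : R -> R) : mu.-integrable setT (EFin \o f) ->
  mu.-integrable setT (EFin \o (fun x => c * f x)).
Proof. by move=> intf; exact: (integrableZl measurableT c intf). Qed.

Lemma is_derive_affine (a b x : R) : is_derive x 1 (fun t : R => a + t * b) b.
Proof.
have := @is_deriveD _ _ _ (cst a) (id * cst b) x 1 _ _ (is_derive_cst a x 1)
  (@is_deriveM _ _ id (cst b) x 1 _ _ (is_derive_id x 1) (is_derive_cst b x 1)).
by rewrite scaler0 !add0r /GRing.scale/= mulr1.
Qed.

(* At frequency 0 the matrix [L] is singular and [invmx] returns a junk value. *)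
Lemma eq_Rintegral_off0 (f g : R -> R) : measurable_fun setT g ->
  (forall x, x != 0 -> f x = g x) -> \int[mu]_x f x = \int[mu]_x g x.
Proof.
move=> mg fg.
(* [f] is not assumed measurable; this form, [g] altered at one point, shows that it is. *)
have -> : f = fun x => if x == 0 then f 0 else g x.
  by apply/funext => x; case: eqVneq => [->//|/fg].
congr fine; apply: ae_eq_integral => //.
- apply/measurable_EFinP; apply: measurable_fun_ifT => //.
  exact: measurable_fun_eqr.
- exact/measurable_EFinP.
- exists [set 0]; split => //; first exact: lebesgue_measure_set1.
  move=> x /=; apply: contra_notP => /eqP/negbTE x0 _.
  by rewrite x0.
Qed.

End RealIntegral.

(** * Modal formula for the performance and the centrality indices *)

Section Centrality.
Context {R : realType} {n m : nat}.
Variable ends : 'I_m -> 'I_n * 'I_n.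
Implicit Type w : 'I_m -> R.
Local Open Scope complex_scope.
Local Notation L := (laplacian R n m ends).
Local Notation mu := (@lebesgue_measure R).

Lemma normsq_delay (lam tau om : R) :
  normsq ((0 +i* om) + (cos (om * tau) -i* sin (om * tau)) * lam%:C) =
  delay_den lam tau om.
Proof.
rewrite /normsq /delay_den /= !(mulr0, mul0r, subr0, add0r, oppr0).
have := cos2Dsin2 (om * tau); set c := cos _; set s := sin _ => H.
transitivity (lam ^+ 2 * (c ^+ 2 + s ^+ 2) + om ^+ 2 - 2 * om * lam * s).
  by ring.
by rewrite H mulr1.
Qed.

(** The strength with which noise channel [k] excites mode [i]. *)
Definition modal_gain u w (P : 'M[R[i]]_n) (i : 'I_n) (k : 'I_(ndim u n m)) : R :=
  normsq ((P *m Cmx R (Bmat R n m ends u w)) i k).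

Definition modal_sum u w P (d : 'I_n -> R) (tau : R) k : R :=
  \sum_(i | d i != 0) @modal_gain u w P i k * delay_int (d i) tau.

(** In the eigenbasis the transfer matrix is [adjC R P *m N], and the unitary factor drops out of
    the trace, leaving the squared moduli of the entries of [N]. The factor [Num.sqrt (s k) ^+ 2] is
    kept because [s k] may be negative here. *)
Lemma transfer_energy u w P d tau s om : weighted_graph R n m ends w ->
  laplacian_diag ends w P d ->
  (forall i, (0 +i* om) + (cos (om * tau) -i* sin (om * tau)) * (d i)%:C != 0) ->
  complex.Re (\tr (adjC R (transfer R n m ends u w tau s om)
    *m transfer R n m ends u w tau s om)) =
  \sum_k Num.sqrt (s k) ^+ 2 *
    \sum_(i | d i != 0) @modal_gain u w P i k * (delay_den (d i) tau om)^-1.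
Proof.
move=> wg dP nz; have [PP LP] := dP.
set z := (0 +i* om) in nz *; set zeta := (cos _ -i* _) in nz *.
pose D1 : 'M[R[i]]_n := diag_mx (\row_i ((d i != 0) : nat)%:R).
pose D2 : 'M[R[i]]_n := diag_mx (\row_i (z + zeta * (d i)%:C)^-1).
pose N := D1 *m D2 *m P *m
  Cmx R (Bmat R n m ends u w *m diag_mx (\row_k Num.sqrt (s k))).
have -> : transfer R n m ends u w tau s om = adjC R P *m N.
  rewrite /transfer (resolvent_diag dP nz) 2!mulmxA (Mcent_diag wg dP).
  by rewrite /N !mulmxA.
rewrite adjC_mul adjCK -mulmxA (mulmxA P) PP mul1mx trace_adjC_mul /=.
apply: eq_bigr => k _; rewrite [in RHS]big_mkcond/= mulr_sumr.
apply: eq_bigr => i _.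
have -> : N i k = ((d i != 0) : nat)%:R * (z + zeta * (d i)%:C)^-1 *
    (P *m Cmx R (Bmat R n m ends u w)) i k * (Num.sqrt (s k))%:C.
  rewrite /N Cmx_mul mulmxA.
  have -> : Cmx R (diag_mx (\row_k Num.sqrt (s k))) =
      diag_mx (\row_k (Num.sqrt (s k))%:C).
    rewrite [LHS]map_diag_mx; congr diag_mx.
    by apply/rowP => l; rewrite !mxE.
  rewrite mul_mx_diag [LHS]mxE [(\row_k _) _ _]mxE; congr (_ * _).
  rewrite /D1 /D2 mulmx_diag -mulmxA mul_diag_mx [LHS]mxE; congr (_ * _).
  by rewrite !mxE.
rewrite 3!normsqM normsq_real (normsqV (nz i)) normsq_delay.
rewrite -(rmorph_nat (real_complex R)) normsq_real /modal_gain.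
by case: eqVneq => di /=; ring.
Qed.

Lemma rho_ssE u w P d tau s : weighted_graph R n m ends w ->
  laplacian_diag ends w P d -> 0 <= tau ->
  (forall i, `|d i| * tau <= 4^-1) ->
  rho_ss R n m ends u w tau s =
  (2 * pi)^-1 * \sum_k Num.sqrt (s k) ^+ 2 * modal_sum w P d tau k.
Proof.
move=> wg dP tau0 small; rewrite /rho_ss; congr (_ * _).
have intd i : d i != 0 ->
    mu.-integrable setT (EFin \o (fun om => (delay_den (d i) tau om)^-1)).
  by move=> di; exact: integrable_delay.
have intm k : mu.-integrable setT (EFin \o (fun om => \sum_(i | d i != 0)
    @modal_gain u w P i k * (delay_den (d i) tau om)^-1)).
  by apply: integrable_Rsum => i di; apply: integrable_Zl; exact: intd.
rewrite (@eq_Rintegral_off0 _ _ (fun om => \sum_k Num.sqrt (s k) ^+ 2 *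
    \sum_(i | d i != 0) @modal_gain u w P i k * (delay_den (d i) tau om)^-1)).
- rewrite Rintegral_sum; last by move=> k _; exact: integrable_Zl.
  apply: eq_bigr => k _; rewrite RintegralZl//; congr (_ * _).
  rewrite Rintegral_sum; last by move=> i di; apply: integrable_Zl; exact: intd.
  by apply: eq_bigr => i di; rewrite RintegralZl//; exact: intd.
- apply/measurable_EFinP; apply: (@measurable_int _ _ _ mu).
  by apply: integrable_Rsum => k _; exact: integrable_Zl.
- move=> om om0; apply: transfer_energy => // i.
  (* For a zero mode the denominator is [i om], nonzero only away from frequency 0; for the other
     modes [delay_den] is positive. *)
  have [->|di] := eqVneq (d i) 0.
    by rewrite mulr0 addr0; apply: contra om0 => /eqP[->].
  apply/eqP => H; have := delay_den_gt0 om di tau0 (small i).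
  by rewrite -normsq_delay H /normsq /= expr0n addr0 ltxx.
Qed.

(** Near unit intensities the performance is an affine function of the intensity of channel [k], so
    the derivative is its slope. *)
Lemma centralityE u w P d tau k : weighted_graph R n m ends w ->
  laplacian_diag ends w P d -> 0 <= tau ->
  (forall i, `|d i| * tau <= 4^-1) ->
  centrality R n m ends u w tau k = (2 * pi)^-1 * modal_sum w P d tau k.
Proof.
move=> wg dP tau0 small; rewrite /centrality derive1E.
pose S := \sum_l @modal_sum u w P d tau l; pose T := modal_sum w P d tau k.
rewrite (@near_eq_derive _ _ _ _ (fun t : R => (2 * pi)^-1 * S + t * ((2 * pi)^-1 * T))).
  by have [] := is_derive_affine ((2 * pi)^-1 * S) ((2 * pi)^-1 * T) 0.
near=> t; rewrite (rho_ssE _ wg dP)//.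
rewrite mulrCA -mulrDr; congr (_ * _).
(* This keeps the intensity [1 + t] positive, so that squaring its [Num.sqrt] gives it back. *)
have t1 : -1 < t.
  by near: t; apply: lt_nbhsr; rewrite ltrN10.
rewrite (eq_bigr (fun l => modal_sum w P d tau l +
   t * (((l == k) : nat)%:R * modal_sum w P d tau l))); last first.
  move=> l _; rewrite sqr_sqrtr; first ring.
  by case: eqP => _ /=; lra.
by rewrite big_split/= -mulr_sumr sum_delta_mul.
Unshelve. all: end_near. Qed.

End Centrality.

(** * Effect of scaling all weights by a common factor *)

Section Scaling.
Context {R : realType} {n m : nat}.
Variable ends : 'I_m -> 'I_n * 'I_n.
Implicit Type w : 'I_m -> R.
Local Open Scope complex_scope.
Local Notation L := (laplacian R n m ends).

(** Needed for [delay_admissible]: a row eigenvector written in the basis [P] has a nonzero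
    coordinate, and that coordinate identifies the eigenvalue. *)
Lemma eigenvalue_diag w P d lam : laplacian_diag ends w P d ->
  eigenvalue (L w) lam -> exists i, lam = d i.
Proof.
move=> [PP LP] /eigenvalueP[v vL v0].
pose y := Cmx R v *m adjC R P.
have yD : y *m diag_mx (\row_i (d i)%:C) = lam%:C *: y.
  transitivity (Cmx R (v *m L w) *m adjC R P).
    by rewrite Cmx_mul LP -!mulmxA PP mulmx1 /y mulmxA.
  by rewrite vL /y scalemxAl; congr (_ *m _); rewrite [LHS]map_mxZ.
have y0 : y != 0.
  apply: contra v0 => /eqP y0; have : y *m P = Cmx R v.
    by rewrite /y -mulmxA (mulmx1C PP) mulmx1.
  rewrite y0 mul0mx => /esym vC0; apply/eqP/rowP => i.
  by have /rowP/(_ i) := vC0; rewrite !mxE => /(@complexI R).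
have /rV0Pn[i yi] := y0; exists i.
have /rowP/(_ i) := yD; rewrite mul_mx_diag [LHS]mxE [RHS]mxE [(\row_i _) _ _]mxE mulrC.
by move=> /(mulIf yi)/(@complexI R) ->.
Qed.

Lemma Wmat_scale a w : Wmat R m (scale_w R m a w) = a *: Wmat R m w.
Proof.
apply/matrixP => i j; rewrite !mxE /scale_w.
by case: eqP => _; rewrite ?mulr1n// !mulr0n mulr0.
Qed.

Lemma laplacian_scale a w : L (scale_w R m a w) = a *: L w.
Proof. by rewrite /laplacian Wmat_scale -scalemxAr -scalemxAl. Qed.

Lemma degmat_scale a w :
  degmat R n m ends (scale_w R m a w) = a *: degmat R n m ends w.
Proof.
apply/matrixP => i j; rewrite !mxE -mulr_sumr.
by case: eqP => _; rewrite ?mulr1n// !mulr0n mulr0.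
Qed.

(* degree of homogeneity of [Bmat u w] in the weights [w] *)
Definition weight_degree (u : unc) : nat :=
  match u with Dynamics | Measurement => 0%N | _ => 1%N end.

Lemma Bmat_scale u a w : Bmat R n m ends u (scale_w R m a w) =
  a ^+ weight_degree u *: Bmat R n m ends u w.
Proof.
case: u => /=; rewrite ?scale1r// expr1.
- exact: laplacian_scale.
- exact: degmat_scale.
- by rewrite /adjmat laplacian_scale degmat_scale scalerBr.
- by rewrite Wmat_scale scalemxAr.
Qed.

Lemma weighted_graph_scale a w : 0 < a -> weighted_graph R n m ends w ->
  weighted_graph R n m ends (scale_w R m a w).
Proof.
by move=> a0 [loopless simple wpos conn]; split=> // e; rewrite mulr_gt0.
Qed.

(** The eigenbasis [P] is unchanged, so delayed and delay-free modal sums can be compared term by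
    term. *)
Lemma laplacian_diag_scale a w P d : laplacian_diag ends w P d ->
  laplacian_diag ends (scale_w R m a w) P (fun i => a * d i).
Proof.
move=> [PP LP]; split=> //; rewrite laplacian_scale.
rewrite [LHS](map_mxZ (real_complex R)) -/(Cmx R (L w)) LP.
rewrite scalemxAl scalemxAr; congr (_ *m _ *m _).
apply/matrixP => i j; rewrite !mxE.
by case: eqP => _; rewrite ?mulr1n ?rmorphM// !mulr0n mulr0.
Qed.

Lemma modal_gain_scale u a w P i (k : 'I_(ndim u n m)) :
  modal_gain ends (scale_w R m a w) P i k =
  (a ^+ weight_degree u) ^+ 2 * modal_gain ends w P i k.
Proof.
rewrite /modal_gain Bmat_scale.
rewrite [Cmx R _](map_mxZ (real_complex R)) -scalemxAr mxE normsqM.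
by rewrite normsq_real.
Qed.

(** The squared degree factor comes from the gains and [a^-1] from [delay_int]. Their product is the
    same for all channels, so it cannot affect the ranking. *)
Lemma modal_sum_scale u a w P d tau (k : 'I_(ndim u n m)) : 0 < a -> 0 <= tau ->
  (forall i, `|d i| * (a * tau) <= 4^-1) ->
  modal_sum ends (scale_w R m a w) P (fun i => a * d i) tau k =
  (a ^+ weight_degree u) ^+ 2 / a * modal_sum ends w P d (a * tau) k.
Proof.
move=> a0 tau0 small; rewrite /modal_sum mulr_sumr.
apply: eq_big => [i|i]; first by rewrite mulf_eq0 gt_eqF.
rewrite mulf_eq0 gt_eqF//= => di.
by rewrite modal_gain_scale delay_int_scale//; ring.
Qed.

Lemma modal_sum_cvg u w P d (k : 'I_(ndim u n m)) :
  modal_sum ends w P d del k @[del --> 0^'+] --> modal_sum ends w P d 0 k.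
Proof.
rewrite /modal_sum; elim: (index_enum _) => [|i s IH].
  by under eq_fun do rewrite big_nil; rewrite big_nil; exact: cvg_cst.
under eq_fun do rewrite big_cons; rewrite big_cons.
case: ifPn => [di|_] //; apply: cvgD => //.
by apply: cvgM; [exact: cvg_cst|exact: delay_int_cvg].
Qed.

End Scaling.

(** * Choice of the scaling factor and transfer of the ranking *)

Unset Implicit Arguments.

Theorem theorem12 (R : realType) (n m : nat) (ends : 'I_m -> 'I_n * 'I_n)
  (w : 'I_m -> R) (u : unc) (tau : R) :
  weighted_graph R n m ends w -> 0 < tau ->
  (forall i j : 'I_(ndim u n m),
      centrality R n m ends u w 0 j < centrality R n m ends u w 0 i <-> (i < j)%N) ->
  exists alpha : R, 0 < alpha /\
    delay_admissible R n m ends (scale_w R m alpha w) tau /\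
    (forall i j : 'I_(ndim u n m),
      centrality R n m ends u (scale_w R m alpha w) tau j
        < centrality R n m ends u (scale_w R m alpha w) tau i
      <-> (i < j)%N).
Proof.
move=> wg tau0 rank0.
have [P [d dP]] := symmetric_spectral (laplacian_sym ends w).
have pi2 : 0 < (2 * pi : R)^-1 by rewrite invr_gt0 mulr_gt0// pi_gt0.
have ordered0 (i j : 'I_(ndim u n m)) : (i < j)%N ->
    modal_sum ends w P d 0 j < modal_sum ends w P d 0 i.
  move=> /rank0; rewrite !(centralityE _ wg dP) ?ltr_pM2l// => l;
    by rewrite mulr0.
(* [del] is the effective delay [alpha * tau]; it is chosen first, and [alpha] is recovered as
   [del / tau]. *)
near ((0 : R)^'+) => del.
have del0 : 0 < del by [].
have small i : `|d i| * del <= 4^-1.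
  apply: (@le_trans _ _ ((`|d i| + 1) * del)).
    by rewrite ler_wpM2r ?lerDl// ltW.
  rewrite -ler_pdivlMl ?ltr_wpDl//; move: i; near: del.
  apply: filter_forall => i; apply: nbhs_right_le.
  by rewrite mulr_gt0// invr_gt0 ltr_wpDl.
have ordered (i j : 'I_(ndim u n m)) : (i < j)%N ->
    modal_sum ends w P d del j < modal_sum ends w P d del i.
  (* There are finitely many pairs of channels, so one neighbourhood of 0 serves them all. *)
  move: i j; near: del; apply: filter_forall => i; apply: filter_forall => j.
  case: (ltnP i j) => [ij|_]; last by near=> del.
  have c : modal_sum ends w P d del i - modal_sum ends w P d del j
      @[del --> 0^'+] --> modal_sum ends w P d 0 i - modal_sum ends w P d 0 j.
    by apply: cvgB; exact: modal_sum_cvg.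
  have : \forall del \near 0^'+,
      0 < modal_sum ends w P d del i - modal_sum ends w P d del j.
    by apply: (cvgr_gt _ c); rewrite subr_gt0 ordered0.
  by apply: filterS => del; rewrite subr_gt0.
pose alpha := del / tau.
have alpha0 : 0 < alpha by rewrite divr_gt0.
have alphatau : alpha * tau = del by rewrite divfK// gt_eqF.
exists alpha; split; first exact: alpha0.
split.
  (* Every scaled eigenvalue times [tau] is [d i * del], at most [1/4], while [pi / 2] is at least
     1. *)
  move=> lam /(eigenvalue_diag (laplacian_diag_scale alpha dP))[i ->].
  rewrite mulrA (mulrC tau) alphatau mulrC.
  apply: (@le_lt_trans _ _ 4^-1).
    by apply: le_trans (small i); rewrite ler_wpM2r ?ler_norm// ltW.
  by have := @pi_ge2 R; lra.
have centE k : centrality R n m ends u (scale_w R m alpha w) tau k =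
    (2 * pi)^-1 * ((alpha ^+ weight_degree u) ^+ 2 / alpha *
      modal_sum ends w P d del k).
  rewrite (centralityE _ (weighted_graph_scale alpha0 wg)
    (laplacian_diag_scale alpha dP)) ?(ltW tau0)//.
    by rewrite modal_sum_scale ?alphatau// ltW.
  by move=> i; rewrite normrM (gtr0_norm alpha0) mulrAC alphatau mulrC.
move=> i j; rewrite !centE ltr_pM2l// ltr_pM2l; last first.
  by rewrite divr_gt0// !exprn_gt0.
(* The converse follows by trichotomy: [j < i] would give the opposite strict inequality, and
   [i = j] contradicts irreflexivity. *)
split=> [|/ordered//]; case: (ltngtP i j) => // [/ordered/ltW|/val_inj ->].
  by rewrite leNgt => /negP.
by rewrite ltxx.
Unshelve. all: end_near. Qed.
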